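(* Let $r\ge k\ge 2$ be integers. Then, as $x\to\infty$, $$\sum_{n_1,\ldots,n_r\le x}\varrho_{r,k}(n_1,\ldots,n_r)=A_{r,k}\,x^r+O\left(R_{r,k}(x)\right),$$ where $$A_{r,k}=\prod_p\left(1-\sum_{j=k}^r(-1)^{j-k}\binom{r}{j}\binom{j-1}{k-1}\frac1{p^j}\right),$$ the product being over all primes $p$, and $$R_{r,k}(x)=\begin{cases}x^{r-1}, & \text{if } r\ge k\ge 3,\\ x^{r-1}(\log x)^{r-1}, & \text{if } r\ge k=2.\end{cases}$$ The implied constant depends only on $r$.
   Context: Positive integers $n_1,\ldots,n_r$ are called $k$-wise relatively prime if $\gcd(n_{i_1},\ldots,n_{i_k})=1$ for every $1\le i_1<\cdots<i_k\le r$. The function $\varrho_{r,k}$ is the characteristic function of the set of $r$-tuples of positive integers whose components are $k$-wise relatively prime: $\varrho_{r,k}(n_1,\ldots,n_r)=1$ if $n_1,\ldots,n_r$ are $k$-wise relatively prime and $0$ otherwise. The sum runs over all $r$-tuples of positive integers $n_1,\ldots,n_r$ each at most the real number $x$. *)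

(* Defs.v *)
From HB Require Import structures.
From mathcomp Require Import all_boot all_order all_algebra.
From mathcomp Require Import all_classical all_reals all_analysis.

Set Implicit Arguments.
Unset Strict Implicit.
Unset Printing Implicit Defensive.

Import Order.TTheory GRing.Theory Num.Theory.
Import numFieldNormedType.Exports.

Local Open Scope classical_set_scope.
Local Open Scope ring_scope.

(* Index choices i_1 < ... < i_k correspond to k-element subsets I of 'I_r;
   0 is the neutral element of gcdn. *)
Definition kwise_coprime (r k : nat) (n : 'I_r -> nat) : bool :=
  [forall I : {set 'I_r},
     (#|I| == k) ==> (\big[gcdn/0%N]_(i in I) n i == 1%N)].

Definition varrho (R : realType) (r k : nat) (n : 'I_r -> nat) : R :=
  (kwise_coprime k n)%:R.

(* For a natural number m and x >= 0, m <= x iff m <= Num.truncn x, so the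
   r-tuples of positive integers at most x are the positive functions
   'I_r -> {0, ..., Num.truncn x}. *)
Definition varrho_sum (R : realType) (r k : nat) (x : R) : R :=
  \sum_(n : {ffun 'I_r -> 'I_(Num.truncn x).+1} | [forall i, (0 < n i)%N])
     varrho R k (fun i => nat_of_ord (n i)).

Definition euler_factor (R : realType) (r k p : nat) : R :=
  1 - \sum_(k <= j < r.+1)
        (-1) ^+ (j - k) * 'C(r, j)%:R * 'C(j.-1, k.-1)%:R / p%:R ^+ j.

Definition euler_partial (R : realType) (r k N : nat) : R :=
  \prod_(0 <= p < N | prime p) euler_factor R r k p.

Definition A (R : realType) (r k : nat) : R := limn (euler_partial R r k).

Definition error_term (R : realType) (r k : nat) (x : R) : R :=
  if (3 <= k)%N then x ^+ r.-1 else x ^+ r.-1 * ln x ^+ r.-1.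

(* Main.v *)
(* Write [#|T| < k] as the sum over [S \subset T] of [psi #|S|].  Summing over the
   tuples with all entries at most x and peeling off the primes p <= x one by
   one, the count becomes a signed sum of products of floors of [x / d_i], where
   each prime p in turn multiplies the [d_i] with i in S by p.  Dropping the
   floors gives [x ^ r] times the truncated Euler product.  Since a product of
   floors differs from the product by at most the sum of the products with one
   factor omitted, the error is at most [r x^(r-1)] times the maximum over i of
   the product over p <= x of the sums over S of [|psi #|S|| p^(-|S \ i|)].
   For k >= 3 only empty S and |S \ i| >= 2 contribute and this product is bounded;
   for k = 2 the r - 1 pairs {i, j} add (r-1)/p, and Mertens' upper bound for the
   sum of 1/p gives (log x)^(r-1).  The tail of the Euler product is O(1/x). *)
Require Import Defs.
From HB Require Import structures.
From mathcomp Require Import all_boot all_order all_algebra.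
From mathcomp Require Import all_classical all_reals all_analysis.
From mathcomp Require unstable.
From mathcomp Require Import ring lra zify.

Set Implicit Arguments.
Unset Strict Implicit.
Unset Printing Implicit Defensive.

Import Order.TTheory GRing.Theory Num.Theory.
Import numFieldNormedType.Exports.

Local Open Scope classical_set_scope.
Local Open Scope ring_scope.

(** * Binomial sums and Moebius inversion over subsets *)

Lemma sum_powerset_card (V : zmodType) (T : finType) (B : {set T})
    (h : nat -> V) :
  \sum_(S : {set T} | S \subset B) h #|S| =
  \sum_(0 <= j < #|B|.+1) h j *+ 'C(#|B|, j).
Proof.
rewrite (partition_big (fun S : {set T} => inord #|S| : 'I_#|B|.+1) predT) //=.
rewrite big_mkord; apply: eq_bigr => j _.
have E (S : {set T}) : (S \subset B) && (inord #|S| == j :> 'I_#|B|.+1) =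
    (S \in [set S : {set T} | S \subset B & #|S| == j]).
  rewrite inE; case SB: (S \subset B) => //=.
  by rewrite -val_eqE /= inordK // ltnS subset_leq_card.
rewrite (eq_bigl _ _ E) (eq_bigr (fun=> h j)) ?sumr_const ?cards_draws //.
by move=> S; rewrite inE => /andP[_ /eqP ->].
Qed.

(** Since C(t, j) C(j, k) = C(t, k) C(t - k, j - k), the sum equals C(t, k) (1 - 1)^(t - k). *)
Lemma sum_binM (R : comPzRingType) (t k : nat) :
  \sum_(k <= j < t.+1) (-1) ^+ (j - k) * 'C(t, j)%:R * 'C(j, k)%:R =
  (k == t)%:R :> R.
Proof.
have [kt|tk] := leqP k t; last first.
  by rewrite big_geq // (gtn_eqF tk).
rewrite -{1}[k]add0n big_addn subSn // big_mkord.
have E (i : 'I_(t - k).+1) : true ->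
    (-1) ^+ (i + k - k) * 'C(t, i + k)%:R * 'C(i + k, k)%:R =
    'C(t, k)%:R * (1 ^+ (t - k - i) * (-1) ^+ i *+ 'C(t - k, i)) :> R.
  move=> _; rewrite addnK expr1n mul1r.
  suff e : ('C(t, i + k) * 'C(i + k, k) = 'C(t, k) * 'C(t - k, i))%N.
    by rewrite -[_ ^+ _ *+ _]mulr_natr mulrCA -natrM -e natrM mulrA.
  have ikt : (i + k <= t)%N by have := ltn_ord i; lia.
  have A1 := bin_fact ikt; have A2 := bin_fact (leq_addl i k).
  have A3 := bin_fact kt.
  have ik : (i <= t - k)%N by lia.
  have A4 := bin_fact ik; rewrite addnK in A2.
  have e : (t - k - i = t - (i + k))%N by lia.
  rewrite e in A4.
  have f1 := fact_gt0 i; have f2 := fact_gt0 k; have f3 := fact_gt0 (t - (i + k)).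
  have P : (0 < i`! * k`! * (t - (i + k))`!)%N by rewrite !muln_gt0 f1 f2 f3.
  apply/eqP; rewrite -(eqn_pmul2r P); apply/eqP.
  transitivity (t`!)%N; [rewrite -A1 -A2 | rewrite -A3 -A4]; ring.
rewrite (eq_bigr _ E) -big_distrr /= -exprDn subrr.
rewrite expr0n subn_eq0.
have [e|ne] := eqVneq k t; first by rewrite e leqnn binn mulr1.
by rewrite leqNgt ltn_neqAle ne kt mulr0.
Qed.

(** By Pascal's rule, passing from t to t + 1 adds the sum of [sum_binM], which is nonzero only for
    t = k. *)
Lemma alt_sum_binM (R : comPzRingType) (t k : nat) :
  \sum_(k <= j < t) (-1) ^+ (j - k) * 'C(t, j.+1)%:R * 'C(j, k)%:R =
  (k < t)%:R :> R.
Proof.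
elim: t => [|t IH]; first by rewrite big_geq.
under eq_bigr do rewrite binS natrD mulrDr mulrDl.
rewrite big_split /= sum_binM.
have [kt|tk] := leqP k t; last first.
  by rewrite big_geq // ltnS leqNgt tk (gtn_eqF tk) add0r.
rewrite big_nat_recr //= bin_small // mulr0 mul0r addr0 IH ltnS kt.
by rewrite ltn_neqAle kt andbT; case: eqVneq => _; rewrite ?addr0 ?add0r.
Qed.

(* The Moebius transform of the indicator of [#|T| < k], as a function of
   cardinalities. *)
Definition psi (R : realType) (k j : nat) : R :=
  (j == 0)%N%:R - (k <= j)%N%:R * ((-1) ^+ (j - k) * 'C(j.-1, k.-1)%:R).

(** The free variable z serves two purposes: z = 1 yields the inversion formula [sum_psi1], and z =
    1/p yields the Euler factor at p. *)
Lemma sum_psi (R : realType) (k t : nat) (z : R) : (0 < k)%N ->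
  \sum_(0 <= j < t.+1) (psi R k j * z ^+ j) *+ 'C(t, j) =
  1 - \sum_(k <= j < t.+1)
        (-1) ^+ (j - k) * 'C(t, j)%:R * 'C(j.-1, k.-1)%:R * z ^+ j.
Proof.
move=> k0.
under eq_bigr do rewrite /psi mulrBl mulrnBl.
rewrite sumrB; congr (_ - _).
  rewrite big_nat_recl // expr0 mulr1 big1 ?addr0 ?bin0 ?mulr1n // => j _.
  by rewrite mul0r mul0rn.
have [kt|tk] := leqP k t.+1; last first.
  rewrite [RHS]big_geq; last exact: ltnW.
  rewrite big_nat big1 // => j /andP[_ jt].
  by rewrite leqNgt (leq_trans jt (ltnW tk)) !mul0r mul0rn.
rewrite (big_cat_nat (leq0n k) kt) /= big_nat big1 ?add0r.
  rewrite big_nat [RHS]big_nat; apply: eq_bigr => j /andP[kj _].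
  by rewrite kj mul1r -mulr_natr; ring.
by move=> j /andP[_ jk]; rewrite leqNgt jk !mul0r mul0rn.
Qed.

Lemma sum_psi1 (R : realType) (k : nat) (T : finType) (B : {set T}) :
  (0 < k)%N ->
  \sum_(S : {set T} | S \subset B) psi R k #|S| = (#|B| < k)%:R.
Proof.
move=> k0; rewrite (sum_powerset_card B (psi R k)).
have := sum_psi #|B| (1 : R) k0; under eq_bigr do rewrite expr1n mulr1.
move=> ->; under eq_bigr do rewrite expr1n mulr1.
case: k k0 => // k _; rewrite big_add1 /=.
have -> : (\sum_(k <= i < #|B|) (-1) ^+ (i.+1 - k.+1) * 'C(#|B|, i.+1)%:R *
    'C(i, k)%:R = (k < #|B|)%:R :> R) by rewrite -alt_sum_binM.
by rewrite ltnS; case: leqP; rewrite ?subrr ?subr0.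
Qed.

Lemma euler_factorE (R : realType) (r k p : nat) : (0 < k)%N ->
  euler_factor R r k p =
  \sum_(S : {set 'I_r}) psi R k #|S| * (p%:R^-1) ^+ #|S|.
Proof.
move=> k0; have := sum_powerset_card [set: 'I_r]
  (fun j => psi R k j * (p%:R^-1) ^+ j).
rewrite cardsT card_ord sum_psi // /euler_factor.
under eq_bigl do rewrite finset.subsetT.
by move=> ->; under [in RHS]eq_bigr do rewrite exprVn.
Qed.

(** Induction through y_a Y - f_a F = (y_a - f_a) F + y_a (Y - F), where y_a - f_a <= 1 and F <= Y.
    In the sieve, f is the floor of y. *)
Lemma prod_sub_le (R : realDomainType) (I : eqType) (s : seq I) (f y : I -> R) :
  uniq s -> (forall i, 0 <= f i <= y i) -> (forall i, y i <= f i + 1) ->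
  0 <= \prod_(i <- s) y i - \prod_(i <- s) f i <=
  \sum_(i <- s) \prod_(j <- s | j != i) y j.
Proof.
move=> us fy y1; have y0 i : 0 <= y i by case/andP: (fy i); exact: le_trans.
elim: s us => [|a s IH] /=; first by rewrite !big_nil subrr lexx.
case/andP=> as_ /IH/andP[IH0 IH1]; rewrite !big_cons eqxx /=.
have -> : \prod_(j <- s | j != a) y j = \prod_(j <- s) y j.
  rewrite big_seq_cond [RHS]big_seq; apply: eq_bigl => j.
  by case js: (j \in s) => //=; apply: contraNneq as_ => <-.
have -> : \sum_(i <- s) \prod_(j <- a :: s | j != i) y j =
    y a * \sum_(i <- s) \prod_(j <- s | j != i) y j.
  rewrite big_distrr /= big_seq [RHS]big_seq; apply: eq_bigr => i si.
  by rewrite big_cons ifT //; apply: contraNneq as_ => ->.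
set Y := \prod_(j <- s) y j in IH0 IH1 *.
set F := \prod_(j <- s) f j in IH0 IH1 *.
have F0 : 0 <= F by apply: prodr_ge0 => i _; case/andP: (fy i).
have Y0 : 0 <= Y by apply: prodr_ge0 => i _.
have -> : y a * Y - f a * F = (y a - f a) * F + y a * (Y - F) by ring.
have [fa1 fa2] := andP (fy a).
have d0 : 0 <= y a - f a by rewrite subr_ge0.
have d1 : y a - f a <= 1 by rewrite lerBlDl.
have FY : F <= Y by rewrite -subr_ge0.
apply/andP; split; first by rewrite addr_ge0 // mulr_ge0.
rewrite lerD // ?ler_wpM2l //.
by apply: le_trans FY; rewrite ler_piMl.
Qed.

(** * The sieve *)

Section Sieve.
Variables (R : realType) (r N : nat) (x : R).
Hypotheses (Nx : N%:R <= x) (xN : x < N.+1%:R).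

Implicit Types (d : 'I_r -> nat) (h : nat -> R) (ps : seq nat).

Definition multiple_tuple d (n : {ffun 'I_r -> 'I_N.+1}) : bool :=
  [forall i, (0 < n i)%N && (d i %| n i)%N].

Definition divisor_indices (p : nat) (n : {ffun 'I_r -> 'I_N.+1}) :
    {set 'I_r} := [set i | (p %| n i)%N]%SET.

Definition scale_at (S : {set 'I_r}) (p : nat) d : 'I_r -> nat :=
  fun i => (d i * if i \in S then p else 1)%N.

(** [d] records the divisibility conditions already extracted and [ps] lists the primes still to be
    treated; a general [d] lets an induction on [ps] go through. *)
Definition sieve_sum h ps d : R :=
  \sum_(n | multiple_tuple d n) \prod_(p <- ps)
     \sum_(S : {set 'I_r} | S \subset divisor_indices p n) h #|S|.

Lemma count_multiples (e : nat) :
  \sum_(m < N.+1) ((0 < m) && (e %| m))%N%:R = (N %/ e)%:R :> R.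
Proof.
rewrite -natr_sum divn_count_dvd; congr (_%:R).
rewrite -(big_mkord xpredT (fun m => ((0 < m) && (e %| m) : nat)%N)).
rewrite big_ltn // ltnn add0n big_nat [RHS]big_nat.
by apply: eq_bigr => m /andP[-> _].
Qed.

(** The conditions on different coordinates are independent, so the count factors into one-variable
    counts. *)
Lemma sieve_sum_nil h d : sieve_sum h [::] d = \prod_i (N %/ d i)%:R.
Proof.
rewrite /sieve_sum; under [RHS]eq_bigr do rewrite -count_multiples.
rewrite bigA_distr_bigA /= big_mkcond; apply: eq_bigr => n _.
rewrite big_nil; case: ifPn => [/forallP H|].
  by rewrite big1 // => i _; rewrite H.
by rewrite negb_forall => /existsP[i /negPf Hi]; rewrite (bigD1 i) //= Hi mul0r.
Qed.

(** Coprimality splits divisibility by d_i p into divisibility by d_i and by p. *)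
Lemma multiple_tuple_scale p d n (S : {set 'I_r}) :
  (forall i, coprime p (d i)) ->
  multiple_tuple (scale_at S p d) n =
  multiple_tuple d n && (S \subset divisor_indices p n).
Proof.
move=> cop; apply/forallP/andP => [H|[/forallP H /fintype.subsetP SD] i].
  split; first apply/forallP => i.
    by have /andP[-> /=] := H i; apply: dvdn_trans; rewrite dvdn_mulr.
  apply/fintype.subsetP => i iS; rewrite inE.
  have /andP[_] := H i; rewrite /scale_at iS; apply: dvdn_trans.
  by rewrite dvdn_mull.
have /andP[-> /= di] := H i; rewrite /scale_at; case: ifP => iS; last first.
  by rewrite muln1.
rewrite Gauss_dvd ?di ?(coprime_sym (d i)) //=.
by have := SD i iS; rewrite inE.
Qed.

Lemma sieve_sum_cons h p ps d : (forall i, coprime p (d i)) ->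
  sieve_sum h (p :: ps) d =
  \sum_(S : {set 'I_r}) h #|S| * sieve_sum h ps (scale_at S p d).
Proof.
move=> cop; rewrite /sieve_sum.
under eq_bigr do rewrite big_cons big_distrl /=.
rewrite (exchange_big_dep xpredT) //=; apply: eq_bigr => S _.
rewrite big_distrr /=; apply: eq_bigl => n.
by rewrite multiple_tuple_scale.
Qed.

(** [P] is always true for the main term and omits one index i for [boundary], where the exponent
    thus becomes |S \ i|. *)
Lemma prod_scale_at (P : pred 'I_r) (S : {set 'I_r}) p d :
  \prod_(i | P i) (x / (scale_at S p d i)%:R) =
  \prod_(i | P i) (x / (d i)%:R) * p%:R^-1 ^+ #|[set i in S | P i]|.
Proof.
rewrite -prodr_const; under [X in _ = _ * X]eq_bigl do rewrite inE andbC.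
rewrite big_mkcondr -big_split /=; apply: eq_bigr => i _.
rewrite /scale_at; case: ifP; rewrite ?muln1 ?mulr1 // => _.
by rewrite natrM invfM mulrA.
Qed.

Definition boundary d : R := \sum_i \prod_(j | j != i) (x / (d j)%:R).

(** Induction on [ps]. Peeling off p gives a sum over S of errors at [scale_at S p d], weighted by h
    |S|. In the boundary term that omits index i, scaling costs p^(-|S \ i|), so the total weight is
    at most b p for every i. *)
Lemma sieve h (b : nat -> R) ps d :
  uniq ps -> all prime ps -> (forall i, 0 < d i)%N ->
  (forall p i, p \in ps -> coprime p (d i)) ->
  (forall p i, p \in ps ->
     \sum_(S : {set 'I_r}) `|h #|S| | * p%:R^-1 ^+ #|S :\ i| <= b p) ->
  (forall p, p \in ps -> 0 <= b p) ->
  `| sieve_sum h ps d - \prod_i (x / (d i)%:R) *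
      \prod_(p <- ps) \sum_(S : {set 'I_r}) h #|S| * p%:R^-1 ^+ #|S| | <=
  boundary d * \prod_(p <- ps) b p.
Proof.
have x0 : 0 <= x by exact: le_trans (ler0n _ _) Nx.
elim: ps d => [|p ps IH] d /=.
  move=> _ _ d0 _ _ _; rewrite sieve_sum_nil !big_nil !mulr1 distrC.
  (* N <= x < N + 1 places the integer quotient N / d_i within 1 below x / d_i. *)
  have fy i : (0 : R) <= (N %/ d i)%:R <= x / (d i)%:R.
    rewrite ler0n /= ler_pdivlMr ?ltr0n // -natrM.
    by apply: le_trans Nx; rewrite ler_nat leq_divM.
  have y1 i : x / (d i)%:R <= (N %/ d i)%:R + 1.
    rewrite ler_pdivrMr ?ltr0n // natr1 -natrM.
    by apply/ltW/(lt_le_trans xN); rewrite ler_nat ltn_ceil.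
  have /andP[ge0 le] := prod_sub_le (index_enum_uniq 'I_r) fy y1.
  by rewrite ger0_norm.
case/andP=> pps ups /andP[pp aps] d0 cop hb b0.
have bp0 : 0 <= \prod_(q <- ps) b q.
  by rewrite big_seq; apply: prodr_ge0 => q qs; rewrite b0 // inE qs orbT.
rewrite sieve_sum_cons; last by move=> i; apply: cop; rewrite inE eqxx.
rewrite !big_cons.
set a := \prod_(q <- ps) \sum_(S : {set 'I_r}) _ in IH *.
set Y := \prod_i _.
have -> : Y * ((\sum_(S : {set 'I_r}) h #|S| * p%:R^-1 ^+ #|S|) * a) =
   \sum_(S : {set 'I_r}) h #|S| * (Y * p%:R^-1 ^+ #|S| * a).
  by rewrite mulrA mulrC big_distrr big_distrr /=; apply: eq_bigr => S _; ring.
rewrite -sumrB (eq_bigr (fun S : {set 'I_r} => h #|S| *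
  (sieve_sum h ps (scale_at S p d) - Y * p%:R^-1 ^+ #|S| * a))); last first.
  by move=> S _; rewrite mulrBr.
apply: (le_trans (ler_norm_sum _ _ _)).
rewrite (eq_bigr _ (fun S _ => normrM _ _)).
have step (S : {set 'I_r}) :
    `|sieve_sum h ps (scale_at S p d) - Y * p%:R^-1 ^+ #|S| * a| <=
    boundary (scale_at S p d) * \prod_(q <- ps) b q.
  have := IH (scale_at S p d) ups aps.
  rewrite (prod_scale_at xpredT).
  rewrite (_ : [set i in S | true] = S); last first.
    by apply/setP => i; rewrite inE andbT.
  apply.
  - by move=> i; rewrite /scale_at muln_gt0 d0 /=; case: ifP => // _; rewrite prime_gt0.
  (* The new moduli stay coprime to the remaining primes because p does not recur in [ps]. *)
  - move=> q i qs; rewrite /scale_at coprimeMr cop ?inE ?qs ?orbT //=.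
    case: ifP; rewrite ?coprimen1 // => _.
    have pq : prime q by exact: (allP aps).
    rewrite prime_coprime // dvdn_prime2 //.
    by apply: contraNneq pps => <-.
  - by move=> q i qs; apply: hb; rewrite inE qs orbT.
  - by move=> q qs; apply: b0; rewrite inE qs orbT.
apply: (le_trans (ler_sum _ (fun S _ => ler_wpM2l (normr_ge0 _) (step S)))).
rewrite (eq_bigr _ (fun S _ => mulrA _ _ _)) -big_distrl /= mulrA.
apply: ler_wpM2r => //.
rewrite /boundary; under eq_bigr do rewrite big_distrr /=.
(* With the omitted index i outermost, the hypothesis on b p applies to each i separately. *)
rewrite exchange_big /= big_distrl /=; apply: ler_sum => i _.
rewrite (eq_bigr (fun S : {set 'I_r} => \prod_(j | j != i) (x / (d j)%:R) *
    (`|h #|S| | * p%:R^-1 ^+ #|S :\ i|))); last first.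
  move=> S _; rewrite prod_scale_at mulrCA.
  rewrite (_ : [set i0 in S | i0 != i] = S :\ i) //.
  by apply/setP => j; rewrite !inE andbC.
rewrite -big_distrr /=; apply: ler_wpM2l.
  by apply: prodr_ge0 => j _; rewrite divr_ge0.
by apply: hb; rewrite inE eqxx.
Qed.

End Sieve.

(** * Mertens' upper bound for the sum of inverse primes *)

Lemma prime_dvd_fact (p n : nat) : prime p -> (p %| n`!)%N = (p <= n)%N.
Proof.
move=> pp; have p0 := prime_gt0 pp; elim: n => [|n IH].
  by rewrite fact0 dvdn1 leqn0 (gtn_eqF p0) (gtn_eqF (prime_gt1 pp)).
rewrite factS Euclid_dvdM // IH; apply/orP/idP => [[/dvdn_leq -> //|/leqW //]|].
by rewrite leq_eqVlt => /predU1P[->|]; [left; rewrite dvdnn|right].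
Qed.

(** Powers of distinct primes are pairwise coprime. *)
Lemma prod_prime_powers_dvd (s : seq nat) (e : nat -> nat) (n : nat) :
  uniq s -> (forall p, p \in s -> prime p -> (p ^ e p %| n)%N) ->
  (\prod_(p <- s | prime p) p ^ e p %| n)%N.
Proof.
move=> us H; apply/unstable.Gauss_dvd_prod => //.
rewrite pairwise_map; have : uniq [seq p <- s | prime p] by rewrite filter_uniq.
rewrite uniq_pairwise; apply: (sub_in_pairwise (P := prime)).
  move=> p q pp qp /= pq; apply: coprimeXl; apply: coprimeXr.
  by rewrite prime_coprime // dvdn_prime2.
exact: filter_all.
Qed.

(** Erdos's argument by strong induction: an even n > 2 is not prime, and for n = 2k + 1 the primes
    in (k + 1, n] all divide C(n, k), which is at most 4^k. *)
Lemma primorial_le (n : nat) : (\prod_(0 <= p < n.+1 | prime p) p <= 4 ^ n)%N.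
Proof.
have [m] := ubnP n; elim: m n => // m IH n; rewrite ltnS => nm.
have [n2|n2] := leqP n 2.
  by case: n n2 {nm IH} => [|[|[|]]] //= _; rewrite unlock.
have [on|en] := boolP (odd n); last first.
  rewrite big_mkcond big_nat_recr //= ifN; last first.
    apply: contra en => /even_prime[n2'|//]; by rewrite n2' in n2.
  rewrite muln1 -big_mkcond /=; case: n n2 nm en => // n n2 nm en.
  by apply: (leq_trans (IH _ nm)); rewrite leq_exp2l.
pose k := n./2.
have nk : n = k.*2.+1 by rewrite -(odd_double_half n) on.
have k0 : (0 < k)%N by lia.
rewrite (big_cat_nat (n := k.+2)) //=; last by lia.
have -> : (4 ^ n = 4 ^ k.+1 * 4 ^ k)%N by rewrite -expnD; congr (_ ^ _)%N; lia.
apply: leq_mul; first by apply: IH; lia.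
(* C(n, k) = C(n, k + 1) occurs twice in the row sum 2^n = 2 * 4^k. *)
have bin4 : ('C(n, k) <= 4 ^ k)%N.
  have : (\sum_(i < n.+1) 'C(n, i) = 2 ^ n)%N.
    by rewrite -[2%N]/(1 + 1)%N expnDn; apply: eq_bigr => i _; rewrite !exp1n !muln1.
  have kn : (k < n.+1)%N by lia.
  have kn1 : (k.+1 < n.+1)%N by lia.
  rewrite (bigD1 (Ordinal kn)) //= (bigD1 (Ordinal kn1)) //=; last first.
    by rewrite -val_eqE /=; lia.
  have -> : 'C(n, k.+1) = 'C(n, k).
    by rewrite -bin_sub //; congr 'C(n, _)%N; lia.
  have -> : (2 ^ n = 2 * 4 ^ k)%N by rewrite {1}nk expnS -mul2n expnM.
  lia.
apply: leq_trans bin4; apply: dvdn_leq; first by rewrite bin_gt0; lia.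
rewrite (eq_bigr (fun p => p ^ 1)%N) => [|p _]; last by rewrite expn1.
apply: prod_prime_powers_dvd; first exact: iota_uniq.
move=> p; rewrite mem_index_iota expn1 => /andP[kp pn] pp.
have kn : (k <= n)%N by lia.
have : (p %| 'C(n, k) * (k`! * (n - k)`!))%N.
  by rewrite bin_fact // prime_dvd_fact.
(* Since p >= k + 2 exceeds both k and n - k = k + 1, it divides neither factorial. *)
rewrite !Euclid_dvdM // !prime_dvd_fact //; case/or3P => //; lia.
Qed.

(** The exponent is the first term of Legendre's formula for n!. *)
Lemma primorial_fact_dvd (n : nat) :
  (\prod_(0 <= p < n.+1 | prime p) p ^ (n %/ p) %| n`!)%N.
Proof.
apply: prod_prime_powers_dvd; first exact: iota_uniq.
move=> p _ pp; rewrite pfactor_dvdn ?fact_gt0 // logn_fact //.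
by case: n => [|n]; rewrite ?div0n // big_ltn // expn1 leq_addr.
Qed.

Lemma leq_fact_expn (n : nat) : (n`! <= n ^ n)%N.
Proof.
rewrite fact_prod big_nat; have : (\prod_(1 <= i < n.+1 | 0 < i < n.+1) i <=
  \prod_(1 <= i < n.+1 | 0 < i < n.+1) n)%N by apply: leq_prod => i; lia.
by move/leq_trans; apply; rewrite -big_nat prod_nat_const_nat subn1.
Qed.

Section Mertens.
Variable R : realType.
Implicit Types n : nat.

Definition prime_log_sum n : R :=
  \sum_(0 <= p < n.+1 | prime p) ln p%:R / p%:R.

Definition prime_inv_sum n : R := \sum_(0 <= p < n.+1 | prime p) p%:R^-1.

Lemma ln_prodn (s : seq nat) (P : pred nat) (f : nat -> nat) :
  (forall i, P i -> 0 < f i)%N ->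
  ln (\prod_(i <- s | P i) f i)%N%:R = \sum_(i <- s | P i) ln (f i)%:R :> R.
Proof.
move=> f0; have : (0 < \prod_(i <- s | P i) f i)%N /\
   ln (\prod_(i <- s | P i) f i)%N%:R = \sum_(i <- s | P i) ln (f i)%:R :> R.
  apply: (big_rec2 (fun (a : nat) (b : R) => (0 < a)%N /\ ln a%:R = b)).
    by rewrite ln1.
  move=> i a b Pi [a0 <-]; split; first by rewrite muln_gt0 f0.
  by rewrite natrM lnM ?posrE ?ltr0n ?f0.
by case.
Qed.

(** Bound n/p by floor(n/p) + 1: the floors give at most ln n! <= n ln n, and the ones give the log
    of the primorial, at most n ln 4. *)
Lemma prime_log_sum_le n : (0 < n)%N -> prime_log_sum n <= ln n%:R + ln 4.
Proof.
move=> n0; have nR : 0 < n%:R :> R by rewrite ltr0n.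
rewrite -(ler_pM2l nR) mulrDr.
have lnle (a b : nat) : (0 < a)%N -> (a <= b)%N -> ln a%:R <= ln b%:R :> R.
  by move=> a0 ab; rewrite ler_ln ?posrE ?ltr0n ?ler_nat // (leq_trans a0).
have A1 : \sum_(0 <= p < n.+1 | prime p) (n %/ p)%:R * ln p%:R <= n%:R * ln n%:R :> R.
  have -> : n%:R * ln n%:R = ln (n ^ n)%N%:R :> R.
    by rewrite natrX lnXn // mulr_natl.
  apply: le_trans (lnle _ _ (fact_gt0 n) (leq_fact_expn n)).
  have H := dvdn_leq (fact_gt0 n) (primorial_fact_dvd n).
  rewrite (le_trans _ (lnle _ _ _ H)) //; last first.
    by rewrite prodn_cond_gt0 // => p pp; rewrite expn_gt0 prime_gt0.
  rewrite ln_prodn => [|p pp]; last by rewrite expn_gt0 prime_gt0.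
  apply: ler_sum => p pp; rewrite natrX lnXn ?ltr0n ?prime_gt0 //.
  by rewrite mulr_natl.
have A2 : \sum_(0 <= p < n.+1 | prime p) ln p%:R <= n%:R * ln 4 :> R.
  rewrite -ln_prodn => [|p pp]; last by rewrite prime_gt0.
  have -> : n%:R * ln 4 = ln (4 ^ n)%N%:R :> R.
    by rewrite natrX lnXn // mulr_natl.
  by apply: lnle (primorial_le n); apply: prodn_cond_gt0 => p /prime_gt0.
apply: le_trans (lerD A1 A2); rewrite -big_split big_distrr /=.
apply: ler_sum => p pp; have p0 : 0 < p%:R :> R by rewrite ltr0n prime_gt0.
have l0 : 0 <= ln p%:R :> R by rewrite ln_ge0 // ler1n prime_gt0.
rewrite -[X in _ + X]mul1r -mulrDl mulrA mulrAC; apply: ler_wpM2r => //.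
rewrite ler_pdivrMr // natr1 -natrM ler_nat.
exact/ltnW/ltn_ceil/prime_gt0.
Qed.


End Mertens.

Lemma one_sub_inv_le_ln (R : realType) (t : R) : 0 < t -> 1 - t^-1 <= ln t.
Proof.
move=> t0; have /le_ln1Dx : -1 < t^-1 - 1 by rewrite ltrBrDr addNr invr_gt0.
by rewrite addrC subrK lnV ?posrE //; lra.
Qed.

Section MertensInv.
Variable R : realType.

(* Abel summation: for [L n = ln n] and [S = prime_log_sum], the difference
   [prime_inv_sum n - S n / L n] increases by [S n * (1 / L n - 1 / L n.+1)]. *)
Lemma prime_inv_sum_abel n : (2 <= n)%N ->
  prime_inv_sum R n - prime_log_sum R n / ln n%:R <=
  ln (ln n%:R) - ln (ln 2) + ln 4 / ln 2 - ln 4 / ln n%:R.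
Proof.
have lpos (m : nat) : (2 <= m)%N -> 0 < ln m%:R :> R.
  by move=> m2; rewrite ln_gt0 // ltr1n.
have c0 : 0 <= ln 4 :> R by rewrite ln_ge0 // ler1n.
case: n => [|[|n]] // _; elim: n => [|n IH].
  have l2 : ln 2 != 0 :> R by rewrite gt_eqF // (lpos 2%N).
  rewrite /prime_inv_sum /prime_log_sum !unlock /=.
  have -> : 2^-1 + 0 - (ln 2 / 2 + 0) / ln 2 = 0 :> R by field.
  lra.
set m := n.+2 in IH *.
have m2 : (2 <= m)%N by [].
have L0 := lpos m m2; have L'0 := lpos m.+1 (leqW m2).
set L := ln m%:R in IH L0 *; set L' := ln m.+1%:R in L'0 *.
have LL' : L <= L' by rewrite ler_ln ?posrE ?ltr0n // ler_nat.
have m1 : m.+1%:R != 0 :> R by rewrite pnatr_eq0.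
have -> : prime_inv_sum R m.+1 - prime_log_sum R m.+1 / L' =
    prime_inv_sum R m - prime_log_sum R m / L'.
  rewrite /prime_inv_sum /prime_log_sum big_mkcond big_nat_recr //=.
  rewrite -big_mkcond /= [X in _ - X / _]big_mkcond big_nat_recr //=.
  rewrite -big_mkcond /= -/L'; case: ifP => _; last by rewrite !addr0.
  by field; rewrite m1 gt_eqF.
have S_le := prime_log_sum_le R (ltnW m2).
rewrite -/L in S_le.
have uv : L'^-1 <= L^-1 by rewrite lef_pV2.
have d : 1 - L / L' <= ln L' - ln L.
  rewrite -ln_div ?posrE // -[L / L']invrK invf_div.
  by apply: one_sub_inv_le_ln; rewrite divr_gt0.
(* The right side is (1 - L / L') + ln 4 (1/L - 1/L'): [d] bounds the first part by ln L' - ln L,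
   and the second telescopes. *)
have e : (prime_log_sum R m) * (L^-1 - L'^-1) <= (L + ln 4) * (L^-1 - L'^-1).
  by apply: ler_wpM2r => //; rewrite subr_ge0.
have LV : L * L^-1 = 1 by rewrite divff // gt_eqF.
rewrite !mulrBr !mulrDl LV in e.
lra.
Qed.

Lemma prime_inv_sum_le : exists2 C : R, 0 <= C &
  forall n, (2 <= n)%N -> prime_inv_sum R n <= ln (ln n%:R) + C.
Proof.
(* The 1 comes from dividing [prime_log_sum_le] by ln n; the ln 4 / ln n left over cancels in
   [prime_inv_sum_abel]. The absolute value ensures nonnegativity. *)
exists (`|1 - ln (ln 2) + ln 4 / ln 2|); first exact: normr_ge0.
move=> n n2; have := prime_inv_sum_abel n2.
have S_le := prime_log_sum_le R (ltnW n2).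
have L0 : 0 < ln n%:R :> R by rewrite ln_gt0 // ltr1n.
have : prime_log_sum R n / ln n%:R <= 1 + ln 4 / ln n%:R.
  rewrite -[X in X + _](divff (_ : ln n%:R != 0)) ?gt_eqF // -mulrDl.
  by rewrite ler_wpM2r // invr_ge0 ltW.
have := ler_norm (1 - ln (ln 2) + ln 4 / ln 2 : R); lra.
Qed.

Lemma prime_inv_sq_sum_le (n : nat) :
  \sum_(0 <= p < n | prime p) (p%:R^-1 : R) ^+ 2 <= 1.
Proof.
case: n => [|[|n]]; try by rewrite unlock /= ler01.
(* The strengthened bound telescopes, because 1/m^2 <= 1/(m - 1) - 1/m. *)
suff : \sum_(0 <= p < n.+2 | prime p) (p%:R^-1 : R) ^+ 2 <= 1 - n.+1%:R^-1.
  by move/le_trans; apply; rewrite gerBl invr_ge0.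
elim: n => [|n IH]; first by rewrite unlock /= invr1 subrr.
rewrite big_mkcond big_nat_recr // -big_mkcond /=.
have n1 : (0 : R) < n.+1%:R by rewrite ltr0n.
have n2 : (0 : R) < n.+2%:R by rewrite ltr0n.
have : (n.+2%:R^-1 : R) ^+ 2 <= n.+1%:R^-1 - n.+2%:R^-1.
  have -> : n.+1%:R^-1 - n.+2%:R^-1 = n.+1%:R^-1 * n.+2%:R^-1 :> R.
    by rewrite -[n.+2%:R]natr1 in n2 *; field; rewrite !gt_eqF.
  by rewrite expr2 ler_wpM2r ?invr_ge0 // lef_pV2 // ler_nat.
have : 0 <= (n.+2%:R^-1 : R) ^+ 2 by rewrite exprn_ge0 // invr_ge0.
move=> h1 h2; have := lerD IH h2; rewrite addrA subrK.
by case: ifP => // _; apply: le_trans; rewrite addr0 lerDl.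
Qed.

(** From 1 + u <= exp u; the quadratic terms contribute at most K because the inverse prime squares
    sum to at most 1. *)
Lemma prod_primes_le_expR (a K : R) (n : nat) : 0 <= a -> 0 <= K ->
  \prod_(0 <= p < n.+1 | prime p) (1 + a * p%:R^-1 + K * p%:R^-1 ^+ 2) <=
  expR (a * prime_inv_sum R n + K).
Proof.
move=> a0 K0.
have : \prod_(0 <= p < n.+1 | prime p) (1 + a * p%:R^-1 + K * p%:R^-1 ^+ 2) <=
    \prod_(0 <= p < n.+1 | prime p) expR (a * p%:R^-1 + K * p%:R^-1 ^+ 2).
  apply: ler_prod => p _; rewrite -addrA expR_ge1Dx andbT.
  by rewrite !addr_ge0 // mulr_ge0 ?exprn_ge0 // invr_ge0.
move/le_trans; apply; rewrite -expR_sum ler_expR big_split /= -!big_distrr /=.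
by rewrite lerD2l ler_piMr // prime_inv_sq_sum_le.
Qed.

End MertensInv.

(** * Convergence from telescoping increments *)

(** Adding D/n to u_n gives a nonincreasing sequence and subtracting it a nondecreasing one; their
    common limit is squeezed between them. *)
Lemma cvgn_harmonic_steps (R : realType) (u : R^nat) (D : R) :
  (forall n, (0 < n)%N -> `|u n.+1 - u n| <= D * n%:R^-1 - D * n.+1%:R^-1) ->
  cvgn u /\ forall n, (0 < n)%N -> `|u n - limn u| <= D * n%:R^-1.
Proof.
(* The shift discards u_0 and matches [harmonic n] = 1/(n + 1). *)
move=> uD; pose v n := u n.+1.
pose f n : R := v n + D * harmonic n; pose g n : R := v n - D * harmonic n.
have vD n : `|v n.+1 - v n| <= D * harmonic n - D * harmonic n.+1 by exact: uD.
have fS : {homo f : n m / (n <= m)%N >-> m <= n}.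
  apply/nonincreasing_seqP => n; rewrite /f.
  by have := vD n; rewrite ler_norml => /andP[]; lra.
have gS : {homo g : n m / (n <= m)%N >-> n <= m}.
  apply/nondecreasing_seqP => n; rewrite /g.
  by have := vD n; rewrite ler_norml => /andP[]; lra.
have hD : (fun n => D * harmonic n) @ \oo --> (0 : R).
  by rewrite -[0](mulr0 D); apply: cvgMl_tmp; exact: cvg_harmonic.
have gf n m : g n <= f m.
  have D0 : 0 <= D * harmonic (maxn n m).
    (* At n = 1 the hypothesis reads 0 <= D - D/2. *)
    have D0 : 0 <= D by have := le_trans (normr_ge0 _) (uD 1%N isT); lra.
    by rewrite mulr_ge0 // harmonic_ge0.
  apply: (le_trans (gS _ _ (leq_maxl n m))).
  apply: le_trans (fS _ _ (leq_maxr n m)).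
  by rewrite /f /g; lra.
have fc : cvgn f.
  by apply: nonincreasing_is_cvgn => //; exists (g 0%N) => _ [m _ <-].
have gc : cvgn g.
  by apply: nondecreasing_is_cvgn => //; exists (f 0%N) => _ [m _ <-].
have vf : v @ \oo --> limn f.
  rewrite -[limn f]subr0 (_ : v = f \- (fun n => D * harmonic n)).
    exact: cvgB.
  by apply/funext => n; rewrite /f /= addrK.
have vg : limn g = limn f.
  apply/cvg_lim => //; rewrite -[limn f]subr0.
  exact: cvgB.
have uf : u @ \oo --> limn f by rewrite -cvg_shiftS.
split; first by apply/cvg_ex; exists (limn f).
move=> [//|n] _; rewrite (cvg_lim _ uf) //.
have h1 : limn f <= u n.+1 + D * n.+1%:R^-1 := nonincreasing_cvgn_ge fS fc n.
have h2 : limn f >= u n.+1 - D * n.+1%:R^-1.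
  by rewrite -vg; exact: nondecreasing_cvgn_le gS gc n.
by rewrite distrC ler_distl h1 h2.
Qed.

(** * Local factors of the counting function *)

Lemma prod_natr_all (R : pzSemiRingType) (T : Type) (s : seq T) (P : pred T) :
  \prod_(p <- s) (P p)%:R = (all P s)%:R :> R.
Proof.
elim: s => [|a s IH]; first by rewrite big_nil.
by rewrite big_cons IH -natrM mulnb.
Qed.

Definition primes_upto (N : nat) : seq nat :=
  [seq p <- index_iota 0 N.+1 | prime p].

(** A gcd of k entries differs from 1 exactly when some prime divides all k of them, and such a
    prime is at most N. *)
Lemma kwise_coprimeE (r k N : nat) (n : {ffun 'I_r -> 'I_N.+1}) :
  (0 < k)%N -> (forall i, 0 < n i)%N ->
  kwise_coprime k (fun i => n i : nat) =
  all (fun p => #|divisor_indices p n| < k)%N (primes_upto N).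
Proof.
move=> k0 n0; apply/forallP/allP => [H p|H I].
  rewrite mem_filter => /andP[pp _]; rewrite ltnNge; apply/negP => kD.
  have : (0 < #|[set I : {set 'I_r} | I \subset divisor_indices p n & #|I| == k]|)%N.
    by rewrite cards_draws bin_gt0.
  case/card_gt0P => I; rewrite inE => /andP[ID Ik].
  have := H I; rewrite Ik /= => /eqP g1.
  have : (p %| \big[gcdn/0%N]_(i in I) n i)%N.
    by apply/dvdn_biggcdP => i iI; have := fintype.subsetP ID i iI; rewrite inE.
  by rewrite g1 dvdn1 => /eqP p1; rewrite p1 in pp.
apply/implyP => /eqP Ik; apply/negPn/negP => g1.
set g := \big[gcdn/0%N]_(i in I) _ in g1.
have gI i : i \in I -> (g %| n i)%N by move=> iI; apply: biggcdn_inf iI _.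
(* As k > 0, g divides some positive entry n_i <= N, so g is positive and its prime divisors are at
   most N. *)
have /card_gt0P[i iI] : (0 < #|I|)%N by rewrite Ik.
have g0 : (0 < g)%N by exact: dvdn_gt0 (n0 i) (gI i iI).
have pp : prime (pdiv g) by apply: pdiv_prime; rewrite ltn_neqAle eq_sym g1.
have pI j : j \in I -> (pdiv g %| n j)%N.
  by move=> /gI; apply: dvdn_trans; exact: pdiv_dvd.
have /H : pdiv g \in primes_upto N.
  rewrite mem_filter pp mem_index_iota /=.
  exact: leq_ltn_trans (dvdn_leq (n0 i) (pI i iI)) (ltn_ord _).
rewrite ltnNge -Ik => /negP; apply; apply: subset_leq_card.
by apply/fintype.subsetP => j jI; rewrite inE pI.
Qed.

(** The sieve starts with every d_i = 1; by [sum_psi1] its local sums are the indicators that p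
    divides fewer than k entries. *)
Lemma varrho_sumE (R : realType) (r k : nat) (x : R) : (0 < k)%N ->
  varrho_sum r k x =
  sieve_sum (Num.truncn x) (psi R k) (primes_upto (Num.truncn x)) (fun _ : 'I_r => 1%N).
Proof.
move=> k0; rewrite /varrho_sum /sieve_sum.
have E (n : {ffun 'I_r -> 'I_(Num.truncn x).+1}) :
    multiple_tuple (fun=> 1%N) n = [forall i, (0 < n i)%N].
  by apply: eq_forallb => i; rewrite dvd1n andbT.
rewrite [RHS](eq_bigl _ _ E); apply: eq_bigr => n /forallP n0.
rewrite /varrho kwise_coprimeE // -prod_natr_all; apply: eq_bigr => p _.
by rewrite sum_psi1.
Qed.

Lemma bin_le_exp2 (n m : nat) : ('C(n, m) <= 2 ^ n)%N.
Proof.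
elim: n m => [|n IH] [|m]; rewrite ?bin0 ?expn_gt0 ?bin0n //.
by rewrite binS expnS mul2n -addnn leq_add.
Qed.

Lemma card_set_ord (r : nat) : #|{set 'I_r}| = (2 ^ r)%N.
Proof.
by rewrite -[in RHS](card_ord r) -[in RHS]cardsT -card_powerset powersetT cardsT.
Qed.

(** * Bounds for the local weights at a prime *)

Section Weights.
Variables (R : realType) (r k : nat).
Hypothesis k2 : (2 <= k)%N.

Lemma psi0 : psi R k 0 = 1.
Proof. by rewrite /psi eqxx leqNgt (ltnW k2) mul0r subr0. Qed.

Lemma psi_small (j : nat) : (0 < j < k)%N -> psi R k j = 0.
Proof.
case/andP=> j0 jk; rewrite /psi (gtn_eqF j0) leqNgt jk.
by rewrite mul0r subr0.
Qed.

Lemma normr_psi_le (j : nat) : (j <= r)%N -> `|psi R k j| <= 2 ^+ r.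
Proof.
move=> jr; have [->|j0] := posnP j.
  by rewrite psi0 normr1 exprn_ege1 // ler1n.
rewrite /psi (gtn_eqF j0) sub0r normrN; case: leqP => _; last first.
  by rewrite mul0r normr0 exprn_ge0.
rewrite mul1r normrM normrX normrN1 expr1n mul1r normr_nat -natrX ler_nat.
apply: (leq_trans (bin_le_exp2 _ _)); rewrite leq_exp2l //.
exact: leq_trans (leq_pred _) jr.
Qed.

Lemma psi_pair : k = 2 -> `|psi R k 2| = 1.
Proof. by move=> ->; rewrite /psi subnn expr0 binn !mul1r sub0r normrN1. Qed.

Lemma expr_inv_le (p a b : nat) : (0 < p)%N -> (b <= a)%N ->
  (p%:R^-1 : R) ^+ a <= p%:R^-1 ^+ b.
Proof.
move=> p0 ba; apply: ler_wiXn2l => //.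
by rewrite invf_le1 ?ler1n ?ltr0n.
Qed.

(** The empty S gives 1, sizes strictly between 0 and k give 0, and each of the at most 2^r other
    sets gives at most 2^r / p^2. *)
Lemma euler_factor_dist (p : nat) : (0 < p)%N ->
  `|euler_factor R r k p - 1| <= 4 ^+ r * p%:R^-1 ^+ 2.
Proof.
move=> p0; rewrite euler_factorE ?(ltnW k2) //.
rewrite (bigD1 finset.set0) //= cards0 psi0 mul1r expr0 addrAC subrr add0r.
apply: (le_trans (ler_norm_sum _ _ _)).
have H (S : {set 'I_r}) : S != finset.set0 ->
    `|psi R k #|S| * p%:R^-1 ^+ #|S| | <= 2 ^+ r * p%:R^-1 ^+ 2.
  rewrite -card_gt0 => S0; rewrite normrM.
  rewrite [X in _ * X <= _]ger0_norm ?exprn_ge0 ?invr_ge0 //.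
  have [Sk|kS] := ltnP #|S| k.
    by rewrite psi_small ?S0 // normr0 mul0r mulr_ge0 ?exprn_ge0 ?invr_ge0.
  apply: ler_pM; rewrite ?exprn_ge0 ?invr_ge0 //.
    by rewrite normr_psi_le // -[leqRHS]card_ord max_card.
  by apply: expr_inv_le => //; exact: leq_trans kS.
apply: (le_trans (ler_sum _ H)).
rewrite sumr_const -[_ *+ _]mulr_natl mulrA ler_wpM2r ?exprn_ge0 ?invr_ge0 //.
rewrite -[4]/(2 * 2)%N%:R natrM exprMn ler_wpM2r ?exprn_ge0 // -natrX ler_nat.
by rewrite (leq_trans (max_card _)) // card_set_ord.
Qed.

(** Sets with |S \ i| >= 2 fall into the p^(-2) term. The other nonempty S of nonzero weight are
    pairs {i, j}, present only for k = 2; there are r - 1 of them, each contributing 1/p. *)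
Lemma sum_psi_erase (p : nat) (i : 'I_r) : (0 < p)%N ->
  \sum_(S : {set 'I_r}) `|psi R k #|S| | * p%:R^-1 ^+ #|S :\ i| <=
  1 + (k == 2)%N%:R * r.-1%:R * p%:R^-1 + 4 ^+ r * p%:R^-1 ^+ 2.
Proof.
move=> p0; have q0 (m : nat) : 0 <= (p%:R^-1 : R) ^+ m by rewrite exprn_ge0 ?invr_ge0.
have H (S : {set 'I_r}) : true ->
    `|psi R k #|S| | * p%:R^-1 ^+ #|S :\ i| <=
    (S == finset.set0)%:R + (\sum_(j | j != i) (S == [set i; j]%SET)%:R) *
       ((k == 2)%N%:R * p%:R^-1) + 2 ^+ r * p%:R^-1 ^+ 2.
  move=> _; have T1 : 0 <= (S == finset.set0)%:R :> R by [].
  have T2 : 0 <= (\sum_(j | j != i) (S == [set i; j]%SET)%:R) *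
       ((k == 2)%N%:R * p%:R^-1) :> R.
    by rewrite !mulr_ge0 ?sumr_ge0 ?invr_ge0.
  have T3 : 0 <= 2 ^+ r * p%:R^-1 ^+ 2 :> R by rewrite mulr_ge0 ?exprn_ge0.
  have [S0|S0] := posnP #|S|.
    have {}S0 : S = finset.set0 by apply: cards0_eq.
    rewrite {1 2}S0 finset.set0D cards0 psi0 normr1 mul1r S0 eqxx expr0.
    by rewrite S0 in T2; rewrite -addrA lerDl addr_ge0.
  have [Sk|kS] := ltnP #|S| k.
    by rewrite psi_small ?S0 // normr0 mul0r !addr_ge0.
  have [E2|E2] := leqP 2 #|S :\ i|.
    rewrite -[leLHS]add0r lerD ?addr_ge0 //.
    rewrite ler_pM ?exprn_ge0 ?invr_ge0 ?expr_inv_le //.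
    by rewrite normr_psi_le // -[leqRHS]card_ord max_card.
  (* If i were outside S, then |S \ i| = |S| >= k >= 2, against the case assumption. *)
  have := cardsD1 i S; have iS : i \in S.
    by apply: contraLR E2 => /negPf iS; have := cardsD1 i S; rewrite iS add0n => <-; rewrite -leqNgt (leq_trans k2).
  rewrite iS add1n => Si.
  have S1 : #|S :\ i| = 1%N.
    by apply/eqP; rewrite eqn_leq -ltnS E2 -ltnS -Si (leq_trans k2).
  rewrite S1 in Si.
  have kk : k = 2 by apply/eqP; rewrite eqn_leq k2 andbT (leq_trans kS) // Si.
  have /cards1P[j Sj] : #|S :\ i| == 1%N by rewrite S1.
  have ji : j != i by have := finset.set11 j; rewrite -Sj !inE => /andP[].
  have SE : S == [set i; j]%SET by rewrite -(finset.setD1K iS) Sj.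
  rewrite S1 Si psi_pair // mul1r expr1 kk eqxx mul1r.
  rewrite (bigD1 j) //= SE mulrDl mul1r.
  have T4 : 0 <= (\sum_(j0 | (j0 != i) && (j0 != j)) (S == [set i; j0]%SET)%:R) *
       (p%:R^-1) :> R by rewrite !mulr_ge0 ?sumr_ge0 ?invr_ge0.
  by rewrite addrCA -!addrA lerDl !addr_ge0.
apply: (le_trans (ler_sum _ H)).
rewrite !big_split /= -big_distrl /= exchange_big /=.
have one (T : {set 'I_r}) : \sum_(S : {set 'I_r}) (S == T)%:R = 1 :> R.
  by rewrite (bigD1 T) //= eqxx big1 ?addr0 // => S /negPf ->.
rewrite one; under eq_bigr do rewrite one.
rewrite sumr_const cardC1 card_ord.
rewrite sumr_const card_set_ord -[X in _ + X <= _]mulr_natl natrX.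
rewrite (_ : 4 = 2 * 2 :> R) ?exprMn; last by rewrite -natrM.
by rewrite le_eqVlt; apply/orP; left; apply/eqP; ring.
Qed.

End Weights.

(** * Convergence and tail of the Euler product *)

Lemma euler_partialS (R : realType) (r k n : nat) :
  euler_partial R r k n.+1 =
  euler_partial R r k n * (if prime n then euler_factor R r k n else 1).
Proof.
by rewrite /euler_partial big_mkcond big_nat_recr //= -big_mkcond.
Qed.

Lemma euler_partial_le (R : realType) (r k n : nat) : (2 <= k)%N ->
  `|euler_partial R r k n| <= expR (4 ^+ r).
Proof.
move=> k2; case: n => [|n].
  rewrite /euler_partial big_geq // normr1 -expR0 ler_expR exprn_ge0 //.
have := @prod_primes_le_expR R 0 (4 ^+ r) n (lexx 0) (exprn_ge0 _ (ler0n _ _)).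
rewrite mul0r add0r; apply: le_trans.
rewrite /euler_partial normr_prod; apply: ler_prod => p pp.
rewrite normr_ge0 mul0r addr0 /=.
have := euler_factor_dist R r k2 (prime_gt0 pp).
have := ler_normD 1 (euler_factor R r k p - 1).
by rewrite addrC subrK normr1; lra.
Qed.

(** With K = 4^r, consecutive partial products differ by at most K exp(K) / n^2, and 1/n^2 <= 2 (1/n
    - 1/(n + 1)) because n + 1 <= 2n. *)
Lemma euler_partial_cvg (R : realType) (r k : nat) : (2 <= k)%N ->
  cvgn (euler_partial R r k) /\
  forall n, (0 < n)%N ->
    `|euler_partial R r k n - A R r k| <= 2 * 4 ^+ r * expR (4 ^+ r) * n%:R^-1.
Proof.
move=> k2; apply: cvgn_harmonic_steps => n n0.
set K : R := 4 ^+ r; have K0 : 0 <= K by rewrite exprn_ge0.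
have N0 : (0 : R) < n%:R by rewrite ltr0n.
rewrite euler_partialS -mulrBr -[X in _ - X]mulr1 -mulrBr normrM.
have H : `|(if prime n then euler_factor R r k n else 1) - 1| <=
    K * n%:R^-1 ^+ 2.
  case: ifP => pn; first exact: euler_factor_dist.
  by rewrite subrr normr0 mulr_ge0 // exprn_ge0 // invr_ge0.
apply: (le_trans (ler_pM (normr_ge0 _) (normr_ge0 _)
  (euler_partial_le R r n k2) H)).
have n1 : (0 : R) < n.+1%:R by rewrite ltr0n.
have -> : n%:R^-1 - n.+1%:R^-1 = n%:R^-1 * n.+1%:R^-1 :> R.
  by rewrite -natr1 in n1 *; field; rewrite !gt_eqF.
have -> : 2 * K * expR K * (n%:R^-1 * n.+1%:R^-1) =
    expR K * (K * (n%:R^-1 * (2 / n.+1%:R))) by ring.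
rewrite ler_pM2l ?expR_gt0 // ler_wpM2l // expr2 ler_wpM2l ?invr_ge0 //.
rewrite ler_pdivlMr // ler_pdivrMl // -natrM ler_nat; lia.
Qed.

(** * Main term and error term *)

(** The coefficient [a] of 1/p is r - 1 for k = 2 and 0 for larger k, so one application of [sieve]
    covers both cases. *)
Lemma varrho_sum_main (R : realType) (r k : nat) (x a : R) :
  (2 <= k)%N -> 0 <= x -> a = (k == 2)%N%:R * r.-1%:R ->
  `| varrho_sum r k x - x ^+ r * euler_partial R r k (Num.truncn x).+1 | <=
  r%:R * x ^+ r.-1 * expR (a * prime_inv_sum R (Num.truncn x) + 4 ^+ r).
Proof.
move=> k2 x0 ea; set N := Num.truncn x.
have a0 : 0 <= a by rewrite ea mulr_ge0.
pose b (p : nat) : R := 1 + a * p%:R^-1 + 4 ^+ r * p%:R^-1 ^+ 2.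
have b0 p : 0 <= b p.
  by rewrite /b !addr_ge0 // mulr_ge0 // ?exprn_ge0 // invr_ge0.
have Nx : N%:R <= x by rewrite truncn_le.
have xN : x < N.+1%:R by rewrite -truncn_le_nat.
have pr p : p \in primes_upto N -> (0 < p)%N.
  by rewrite mem_filter => /andP[/prime_gt0].
have := @sieve R r N x Nx xN (psi R k) b (primes_upto N) (fun=> 1%N).
rewrite -varrho_sumE ?(ltnW k2) //.
have -> : \prod_(i < r) (x / 1%N%:R) = x ^+ r.
  by rewrite divr1 prodr_const card_ord.
have -> : boundary x (fun _ : 'I_r => 1%N) = r%:R * x ^+ r.-1.
  rewrite /boundary divr1; under eq_bigr do rewrite prodr_const cardC1 card_ord.
  by rewrite sumr_const card_ord mulr_natl.
rewrite /primes_upto !big_filter => H.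
have {}H := H (filter_uniq _ (iota_uniq _ _)) (filter_all _ _)
  (fun=> isT) (fun p _ _ => coprimen1 p).
have E : \prod_(0 <= p < N.+1 | prime p) \sum_(S : {set 'I_r}) psi R k #|S| *
    p%:R^-1 ^+ #|S| = euler_partial R r k N.+1.
  by apply: eq_bigr => p _; rewrite euler_factorE ?(ltnW k2).
rewrite E in H; apply: (le_trans (H _ _)).
- move=> p i /pr p0; rewrite /b ea; exact: sum_psi_erase.
- by move=> p _.
by rewrite ler_wpM2l ?mulr_ge0 ?exprn_ge0 // prod_primes_le_expR // exprn_ge0.
Qed.

Theorem theorem2p2 (R : realType) (r : nat) :
  exists2 C : R, 0 < C &
    forall k : nat, (2 <= k)%N -> (k <= r)%N ->
      cvgn (euler_partial R r k) /\
      \forall x \near +oo,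
        `| varrho_sum r k x - A R r k * x ^+ r | <= C * error_term r k x.
Proof.
have [C0 C0ge0 mertens] := prime_inv_sum_le R.
pose K : R := 4 ^+ r; have K0 : 0 <= K by rewrite exprn_ge0.
(* M collects the bounded part of the sieve error after Mertens' bound; D is the constant in the
   tail of the Euler product. *)
pose M := expR (r.-1%:R * C0 + K); pose D := 2 * K * expR K.
have M0 : 0 < M := expR_gt0 _.
have D0 : 0 <= D by rewrite !mulr_ge0 // expR_ge0.
have rM0 : 0 <= r%:R * M by rewrite mulr_ge0 // ltW.
(* Chosen before [k], the constant depends on r alone; the summand 1 makes it positive. *)
exists (r%:R * M + D + 1) => [|k k2 kr]; first by rewrite ltr_wpDl ?addr_ge0.
have r0 : (0 < r)%N := leq_trans (ltnW k2) kr.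
have [ecvg edist] := euler_partial_cvg R r k2.
split=> //; near=> x.
have x2 : 2 <= x by near: x; exact: nbhs_pinfty_ge.
(* This makes ln x >= 1, so [error_term] dominates x^(r-1) also for k = 2. *)
have xe : expR 1 <= x by near: x; exact: nbhs_pinfty_ge.
have x0 : 0 < x by exact: lt_le_trans x2.
pose N := Num.truncn x.
have Nx : N%:R <= x by rewrite truncn_le ltW.
have xN : x < N.+1%:R by rewrite -truncn_le_nat.
have N2 : (2 <= N)%N by rewrite -ltnS -(ltr_nat R); exact: le_lt_trans xN.
have L1 : 1 <= ln x by rewrite -[leLHS]expRK ler_ln ?posrE // expR_gt0.
have P1 : 1 <= ln x ^+ r.-1 by exact: exprn_ege1.
have X0 : 0 <= x ^+ r.-1 by rewrite exprn_ge0 // ltW.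
have XE : x ^+ r.-1 <= x ^+ r.-1 * ln x ^+ r.-1 by rewrite ler_peMr.
have E0 : x ^+ r.-1 <= error_term r k x by rewrite /error_term; case: ifP.
have B1 : `|varrho_sum r k x - x ^+ r * euler_partial R r k N.+1| <=
    r%:R * M * error_term r k x.
  have := @varrho_sum_main R r k x _ k2 (ltW x0) erefl; rewrite -/N -/K.
  move/le_trans; apply.
  rewrite -!mulrA ler_wpM2l // /error_term mulrC.
  have [k3|k3] := ltnP 2 k.
    rewrite (gtn_eqF k3) !mul0r add0r ler_wpM2r // ler_expR lerDr.
    by rewrite mulr_ge0.
  have -> : k = 2 by apply/eqP; rewrite eqn_leq k2 k3.
  rewrite eqxx mul1r mulrC mulrCA ler_wpM2l //.
  have lN : 0 < ln N%:R :> R by rewrite ln_gt0 // ltr1n.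
  have H1 : r.-1%:R * prime_inv_sum R N + K <=
      (r.-1%:R * C0 + K) + r.-1%:R * ln (ln N%:R).
    have := ler_wpM2l (ler0n R r.-1) (mertens N N2).
    by rewrite mulrDr; lra.
  have := H1; rewrite -ler_expR => /le_trans; apply.
  (* exp((r - 1) ln ln N) = (ln N)^(r-1), and N <= x. *)
  rewrite expRD -/M expRM_natl lnK ?posrE //.
  apply: ler_wpM2l; first exact: ltW.
  apply: lerXn2r; rewrite ?nnegrE ?(ltW lN) ?(le_trans ler01 L1) //.
  by rewrite ler_ln ?posrE // ltr0n ltnW.
have B2 : `|x ^+ r * euler_partial R r k N.+1 - A R r k * x ^+ r| <=
    D * error_term r k x.
  rewrite [A R r k * _]mulrC -mulrBr normrM ger0_norm ?exprn_ge0 ?(ltW x0) //.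
  apply: (@le_trans _ _ (D * x ^+ r.-1)); last exact: ler_wpM2l.
  apply: (le_trans (ler_wpM2l _ (edist N.+1 isT))).
    by rewrite exprn_ge0 // ltW.
  rewrite -/K -/D -[in x ^+ r](prednK r0) exprS mulrCA ler_wpM2l //.
  (* One factor x of x^r is absorbed by 1/(N + 1), since x < N + 1. *)
  rewrite mulrAC ler_piMl // ler_pdivrMr ?ltr0n // mul1r; exact: ltW.
have Ege0 : 0 <= error_term r k x := le_trans X0 E0.
rewrite -[varrho_sum r k x](subrK (x ^+ r * euler_partial R r k N.+1)) -addrA.
apply: (le_trans (ler_normD _ _)); apply: (le_trans (lerD B1 B2)).
by rewrite mulrDl mul1r mulrDl lerDl.
Unshelve. all: by end_near.
Qed.
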